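(* Let $\sigma>0$, $\mu=\mathcal{N}(0,1)$, $\nu=\mathcal{N}(0,\sigma^2)$ on $\mathbb{R}$, $c(x,y)=-xy$, and let Sinkhorn's algorithm with regularization parameter $\lambda>0$ be started at $\psi_0=0$. If $\lambda\le\sigma/5$, then for any integer $t\ge0$ the dual sub-optimality gap $\delta_t$ satisfies $$\delta_t\ge\frac{2\sigma^6}{(\sigma+\lambda)^3}\Big(1-\frac{4\lambda}{\sigma}-\frac{4\lambda^2}{\sigma^2}\Big)^t(\alpha^* )^2,\qquad\text{where }\alpha^*=\frac{\lambda}{4\sigma^2}-\frac{\sqrt{4\sigma^2+\lambda^2}}{4\sigma^2}.$$ Moreover, in the asymptotic regime $\lambda\to0$ (with $\sigma$ fixed), $$\lim_{t\to+\infty}\frac{\delta_{t+1}}{\delta_t}=1-\frac{4\lambda}{\sigma}+o(\lambda).$$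
   Context: $\mathcal{N}(0,s^2)$ is the centered Gaussian measure on $\mathbb{R}$ with variance $s^2$. The $(c,\lambda)$-transforms are $$\phi^{c,\lambda}(y)=-\lambda\log\int \exp\Big(\frac{\phi(x)-c(x,y)}{\lambda}\Big)d\mu(x),\qquad \psi^{c,\lambda}(x)=-\lambda\log\int \exp\Big(\frac{\psi(y)-c(x,y)}{\lambda}\Big)d\nu(y).$$ Sinkhorn's iterates are $\phi_{t+1/2}=\psi_t^{c,\lambda}$, $\psi_{t+1}=\phi_{t+1/2}^{c,\lambda}$ for integers $t\ge0$ (in this Gaussian setting, all iterates are quadratic polynomials and these expressions are finite). The dual functional is $$F(\phi,\psi)=\int\phi\,d\mu+\int\psi\,d\nu+\lambda\Big(1-\iint \exp\Big(\frac{\phi(x)+\psi(y)-c(x,y)}{\lambda}\Big)d\mu(x)d\nu(y)\Big)\in[-\infty,\infty),$$ and the dual sub-optimality gap is $\delta_t=\sup_{\phi\in L^1(\mu),\,\psi\in L^1(\nu)}F(\phi,\psi)-F(\phi_{t+1/2},\psi_t)$. *)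

(* Defs.v *)
From mathcomp Require Import all_boot all_order all_algebra.
From mathcomp Require Import all_classical all_reals all_analysis.
Import Order.TTheory GRing.Theory Num.Theory numFieldNormedType.Exports.

Set Implicit Arguments.
Unset Strict Implicit.
Unset Printing Implicit Defensive.

Local Open Scope classical_set_scope.
Local Open Scope ring_scope.

(* [entropic_transform mu c lam f y] is
     - lam * log (\int exp ((f x - c x y) / lam) dmu(x)).
   The integral is real-valued and [ln] is total, so the formula is meaningful
   when the integral is finite and nonzero. *)
Definition entropic_transform {R : realType} {d : measure_display}
    {X : measurableType d} {Y : Type} (mu : probability X R) (c : X -> Y -> R)
    (lam : R) (f : X -> R) (y : Y) : R :=
  - lam * ln (\int[mu]_x expR ((f x - c x y) / lam)).

Definition phi_transform {R : realType} {d1 d2 : measure_display}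
    {X : measurableType d1} {Y : measurableType d2} (mu : probability X R)
    (c : X -> Y -> R) (lam : R) (phi : X -> R) : Y -> R :=
  entropic_transform mu c lam phi.

Definition psi_transform {R : realType} {d1 d2 : measure_display}
    {X : measurableType d1} {Y : measurableType d2} (nu : probability Y R)
    (c : X -> Y -> R) (lam : R) (psi : Y -> R) : X -> R :=
  entropic_transform nu (fun y x => c x y) lam psi.

Fixpoint sinkhorn_psi {R : realType} {d1 d2 : measure_display}
    {X : measurableType d1} {Y : measurableType d2} (mu : probability X R)
    (nu : probability Y R) (c : X -> Y -> R) (lam : R) (psi0 : Y -> R)
    (t : nat) : Y -> R :=
  if t is t'.+1 then
    phi_transform mu c lam
      (psi_transform nu c lam (sinkhorn_psi mu nu c lam psi0 t'))
  else psi0.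

(* The half-step iterate of index t + 1/2. *)
Definition sinkhorn_phi {R : realType} {d1 d2 : measure_display}
    {X : measurableType d1} {Y : measurableType d2} (mu : probability X R)
    (nu : probability Y R) (c : X -> Y -> R) (lam : R) (psi0 : Y -> R)
    (t : nat) : X -> R :=
  psi_transform nu c lam (sinkhorn_psi mu nu c lam psi0 t).

(* Equal to -oo when the exponential integral diverges (for lam > 0 and
   integrable potentials). *)
Definition dual_functional {R : realType} {d1 d2 : measure_display}
    {X : measurableType d1} {Y : measurableType d2} (mu : probability X R)
    (nu : probability Y R) (c : X -> Y -> R) (lam : R)
    (phi : X -> R) (psi : Y -> R) : \bar R :=
  (\int[mu]_x (phi x)%:E + \int[nu]_y (psi y)%:E
   + lam%:E * (1 - \int[mu \x nu]_z
       (expR ((phi z.1 + psi z.2 - c z.1 z.2) / lam))%:E))%E.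

Definition dual_value {R : realType} {d1 d2 : measure_display}
    {X : measurableType d1} {Y : measurableType d2} (mu : probability X R)
    (nu : probability Y R) (c : X -> Y -> R) (lam : R) : \bar R :=
  ereal_sup [set dual_functional mu nu c lam phi psi
    | phi in [set phi : X -> R | mu.-integrable setT (EFin \o phi)]
    & psi in [set psi : Y -> R | nu.-integrable setT (EFin \o psi)]].

Definition dual_gap {R : realType} {d1 d2 : measure_display}
    {X : measurableType d1} {Y : measurableType d2} (mu : probability X R)
    (nu : probability Y R) (c : X -> Y -> R) (lam : R) (psi0 : Y -> R)
    (t : nat) : \bar R :=
  (dual_value mu nu c lam
   - dual_functional mu nu c lam
       (sinkhorn_phi mu nu c lam psi0 t) (sinkhorn_psi mu nu c lam psi0 t))%E.

(* [normal_prob m s] is parametrized by the standard deviation s, so that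
   the two marginals are N(0, 1) and N(0, sigma^2). *)
Definition gaussian_gap {R : realType} (sigma lam : R) (t : nat) : \bar R :=
  dual_gap (normal_prob (0 : R) 1) (normal_prob (0 : R) sigma)
    (fun x y : R => - (x * y)) lam (fun=> 0) t.

(* Main.v *)
(* All iterates are quadratic. Write psi_t(y) = a_t y^2 + b_t, k = (sigma/lam)^2
   and w_t = 1 - 2 a_t sigma^2/lam; then w_0 = 1, w_(t+1) = 1 + k/(1 + k/w_t), and
   this recursion increases to the positive root W of W^2 = W + k.  A half-step
   normalizes one marginal of the coupling exp((phi + psi - c)/lam), so the dual
   functional reduces to int phi dmu + int psi dnu = lam/2 (1 + E(w_t)) with
   E(w) = ln w - w - k/w.  At w = W both marginals are normalized, and
   exp(u) >= exp(u0) (1 + u - u0) makes these potentials optimal, hence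
   delta_t = lam/2 (E(W) - E(w_t)).  Since E'(w) = (W - w)(w + W - 1)/w^2, the gap
   is comparable to (W - w_t)^2, with constants that agree in the limit w_t -> W,
   while W - w_(t+1) = (1 - 1/W) k/(w_t + k) (W - w_t).  The limiting ratio is
   therefore (1 - 1/W)^4, and 1/W = lam/sigma + O(lam^2). *)
Require Import Defs.
From mathcomp Require Import all_boot all_order all_algebra.
From mathcomp Require Import all_classical all_reals all_analysis.
From mathcomp Require Import measurable_realfun ring lra.
Import Order.TTheory GRing.Theory Num.Theory numFieldNormedType.Exports.

Set Implicit Arguments.
Unset Strict Implicit.
Unset Printing Implicit Defensive.

Local Open Scope classical_set_scope.
Local Open Scope ring_scope.

(** * Gaussian integrals *)

(** The change of variables yields an abstract Radon-Nikodym derivative. It agrees almost everywhere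
    with [normal_pdf], because both have the same integral over every measurable set. *)
Lemma ge0_integral_normal_prob (R : realType) (m s : R) (f : R -> R) :
  (forall x, 0 <= f x) -> measurable_fun [set: R] f ->
  (\int[normal_prob m s]_x (f x)%:E =
   \int[lebesgue_measure]_x (f x * normal_pdf m s x)%:E)%E.
Proof.
move=> f_ge0 mf.
have dom := @normal_prob_dominates R m s.
have mEf : measurable_fun [set: R] (EFin \o f) by exact/measurable_EFinP.
rewrite -(Radon_Nikodym_SigmaFinite.change_of_variables dom)//.
apply: ae_eq_integral => //.
- apply: emeasurable_funM => //.
  exact: measurable_int (Radon_Nikodym_SigmaFinite.f_integrable dom).
- apply/measurable_EFinP/measurable_funM => //.
  exact: measurable_normal_pdf.
- have : ae_eq lebesgue_measure setT
      (Radon_Nikodym_SigmaFinite.f (normal_prob m s) lebesgue_measure)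
      (EFin \o normal_pdf m s).
    apply: integral_ae_eq => //.
    + exact: (Radon_Nikodym_SigmaFinite.f_integrable dom).
    + by apply/measurable_EFinP; exact: measurable_normal_pdf.
    + by move=> E _ mE; rewrite -Radon_Nikodym_SigmaFinite.f_integral.
  by apply: filterS => x /= fE _; rewrite fE.
Qed.

(** Completing the square: the integrand times the density is a constant times the density of a
    Gaussian with mean [q s^2 / D] and variance [s^2 / D]. *)
Lemma integral_normal_prob_expR_quadratic (R : realType) (s p q : R) :
  0 < s -> 0 < 1 - 2 * p * s ^+ 2 ->
  let D := 1 - 2 * p * s ^+ 2 in
  (\int[normal_prob 0 s]_x (expR (p * x ^+ 2 + q * x))%:E =
   ((Num.sqrt D)^-1 * expR (q ^+ 2 * s ^+ 2 / (2 * D)))%:E)%E.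
Proof.
move=> s_gt0 D_gt0 D.
have s0 : s != 0 by rewrite gt_eqF.
have D0 : D != 0 by rewrite gt_eqF.
rewrite ge0_integral_normal_prob; last 2 first.
- by move=> x; exact: expR_ge0.
- apply: measurableT_comp => //.
  by apply: measurable_funD; apply: measurable_funM => //; exact: measurable_funX.
pose s' := s / Num.sqrt D.
have sD_gt0 : 0 < Num.sqrt D by rewrite sqrtr_gt0.
have sD0 : Num.sqrt D != 0 by rewrite gt_eqF.
have s'_gt0 : 0 < s' by rewrite divr_gt0.
have s'0 : s' != 0 by rewrite gt_eqF.
have s'2 : s' ^+ 2 = s ^+ 2 / D by rewrite expr_div_n sqr_sqrtr// ltW.
pose m' := q * s ^+ 2 / D.
set C := (X in _ = X%:E).
have E x : expR (p * x ^+ 2 + q * x) * normal_pdf 0 s x = C * normal_pdf m' s' x.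
  rewrite !normal_pdfE// /normal_fun.
  have -> : normal_peak s' = Num.sqrt D * normal_peak s.
    rewrite /normal_peak s'2 (_ : _ *+ 2 = D^-1 * (s ^+ 2 * pi *+ 2)); last by field.
    by rewrite sqrtrM ?invr_ge0 ?ltW// invfM sqrtrV ?ltW// invrK.
  rewrite [LHS]mulrCA /C [RHS]mulrACA mulKf// -!expRD.
  have pE : p = (1 - D) / (2 * s ^+ 2) by rewrite /D; field.
  congr (_ * expR _); rewrite s'2 /m' subr0 pE; field.
  by rewrite s0 D0.
under eq_integral do rewrite E EFinM.
rewrite integralZl//; last exact: integrable_normal_pdf.
by rewrite integral_normal_pdf mule1.
Qed.

Lemma integrable_normal_prob_sqr (R : realType) (s : R) : 0 < s ->
  (normal_prob 0 s).-integrable [set: R] (EFin \o (fun x : R => x ^+ 2)).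
Proof.
move=> s_gt0; have s0 : s != 0 by rewrite gt_eqF.
have mX : measurable_fun [set: R] (EFin \o (fun x : R => x ^+ 2)).
  by apply/measurable_EFinP; exact: measurable_funX.
(* With this [p] the factor [1 - 2 p s^2] is 1/2, so [exp (p x^2)], which dominates [p x^2], has a
   finite integral. *)
pose p := (4 * s ^+ 2)^-1.
have p_gt0 : 0 < p by rewrite invr_gt0 mulr_gt0// exprn_gt0.
have D_gt0 : 0 < 1 - 2 * p * s ^+ 2.
  by rewrite (_ : _ - _ = 2^-1) ?invr_gt0// /p; field.
apply/integrableP; split => //.
have : (\int[normal_prob 0 s]_x (p * x ^+ 2)%:E < +oo)%E.
  apply: (@le_lt_trans _ _ (\int[normal_prob 0 s]_x (expR (p * x ^+ 2 + 0 * x))%:E)%E).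
    apply: ge0_le_integral => //.
    - by move=> x _; rewrite lee_fin mulr_ge0 ?sqr_ge0 ?ltW.
    - apply/measurable_EFinP/measurable_funM => //; exact: measurable_funX.
    - apply/measurable_EFinP/measurableT_comp => //; apply: measurable_funD => //.
      apply: measurable_funM => //; exact: measurable_funX.
    - move=> x _; rewrite lee_fin mul0r addr0.
      by apply: le_trans (expR_ge1Dx _); rewrite lerDr.
  by rewrite integral_normal_prob_expR_quadratic// ltry.
under eq_integral do rewrite EFinM.
rewrite ge0_integralZl//; last 2 first.
- by move=> x _; rewrite lee_fin sqr_ge0.
- by rewrite lee_fin ltW.
under [X in _ -> (X < _)%E]eq_integral do rewrite /= ger0_norm ?sqr_ge0//.
case: (integral _ _ _) => [r||] //=.
- by move=> _; rewrite ltry.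
- by rewrite gt0_muley ?lte_fin.
Qed.

(** No integration by parts: the integral of [exp (p x^2)] is known in closed form, and
    [exp u >= 1 + u] bounds it below by [1 + p V], with [V] the second moment. Admissible [p] of
    both signs then determine [V]. *)
Lemma integral_normal_prob_sqr (R : realType) (s : R) : 0 < s ->
  (\int[normal_prob 0 s]_x (x ^+ 2)%:E = (s ^+ 2)%:E)%E.
Proof.
move=> s_gt0; have s0 : s != 0 by rewrite gt_eqF.
have iX := integrable_normal_prob_sqr s_gt0.
have /fineK := integrable_fin_num measurableT iX.
set V := fine _ => /= VE.
have V_ge0 : 0 <= V.
  by rewrite -lee_fin VE integral_ge0// => x _; rewrite lee_fin sqr_ge0.
have main p : 0 < 1 - 2 * p * s ^+ 2 ->
    1 + p * V <= (Num.sqrt (1 - 2 * p * s ^+ 2))^-1.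
  move=> D_gt0.
  have := integral_normal_prob_expR_quadratic 0 s_gt0 D_gt0.
  rewrite expr0n/= !mul0r expR0 mulr1 -lee_fin => <-.
  rewrite EFinD EFinM VE -integralZl//.
  have -> : 1%:E = (\int[normal_prob 0 s]_x 1%:E)%E.
    by rewrite integral_cst// mul1e; apply/esym; exact: probability_setT.
  rewrite -integralD//; last 2 first.
  - exact: finite_measure_integrable_cst.
  - exact: integrableZl.
  apply: le_integral => //.
  - by apply: integrableD => //;
      [exact: finite_measure_integrable_cst|exact: integrableZl].
  - apply/integrableP; split.
      apply/measurable_EFinP/measurableT_comp => //; apply: measurable_funD => //.
      by apply: measurable_funM => //; exact: measurable_funX.
    under eq_integral do rewrite /= ger0_norm ?expR_ge0//.
    by rewrite integral_normal_prob_expR_quadratic// ltry.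
  - by move=> x _; rewrite -EFinM -EFinD lee_fin mul0r addr0 expR_ge1Dx.
pose m := V / s ^+ 2.
have VsE : V = m * s ^+ 2 by rewrite /m divfK// expf_eq0.
have m_ge0 : 0 <= m by rewrite divr_ge0// sqr_ge0.
(* With [v = p s^2] and [m = V / s^2] the bound reads [1 + v m <= (1 - 2 v)^(-1/2)];
   both sides are equal at [v = 0], so comparing slopes forces [m = 1]. *)
have {}main v : 0 < 1 - 2 * v -> 0 <= 1 + v * m -> (1 + v * m) ^+ 2 * (1 - 2 * v) <= 1.
  move=> v_lt vm_ge0.
  have E : 2 * (v / s ^+ 2) * s ^+ 2 = 2 * v by field.
  have := main (v / s ^+ 2); rewrite E => /(_ v_lt).
  have -> : v / s ^+ 2 * V = v * m by rewrite VsE; field.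
  rewrite -[X in _ <= X]mul1r ler_pdivlMr ?sqrtr_gt0// => le1.
  rewrite -[X in _ * X](sqr_sqrtr (ltW v_lt)) -exprMn.
  by rewrite expr_le1// mulr_ge0// sqrtr_ge0.
rewrite -VE; congr EFin; rewrite VsE -[RHS]mul1r; congr (_ * _).
apply/eqP; rewrite eq_le; apply/andP; split; rewrite leNgt; apply/negP => m1.
- have m_gt0 : 0 < m by lra.
  (* The left side of [main] has slope [2 (m - 1)] at [v = 0], so a small [v] of the sign of [m - 1]
     pushes it above 1. For this [v] the bound amounts to [(m - 1)^2 (m + 9) <= 0]. *)
  have := main ((m - 1) / (4 * m)).
  have -> : 1 - 2 * ((m - 1) / (4 * m)) = (m + 1) / (2 * m) by field; rewrite gt_eqF.
  have -> : 1 + (m - 1) / (4 * m) * m = (m + 3) / 4 by field; rewrite gt_eqF.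
  have H1 : 0 < (m + 1) / (2 * m) by rewrite divr_gt0//; lra.
  have H2 : 0 <= (m + 3) / 4 by lra.
  move=> /(_ H1 H2); rewrite mulrA ler_pdivrMr; last by lra.
  have : 0 < (m - 1) ^+ 2 * (m + 9).
    by rewrite mulr_gt0 ?exprn_gt0 ?subr_gt0//; lra.
  nra.
(* Same idea with a negative [v]: the excess over 1 is a positive multiple of
   [(1 - m)^2 (16 - 8 m + 3 m^2 - m^3)], which is positive for [0 <= m < 1]. *)
- have := main (- (1 - m) / 4).
  have H1 : 0 < 1 - 2 * (- (1 - m) / 4) by lra.
  have H2 : 0 <= 1 + - (1 - m) / 4 * m by nra.
  move=> /(_ H1 H2).
  have : 0 < (1 - m) ^+ 2 * (16 - 8 * m + 3 * m ^+ 2 - m ^+ 3).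
    rewrite mulr_gt0 ?exprn_gt0 ?subr_gt0//.
    have : m ^+ 3 <= 1 by rewrite exprn_ile1// ltW.
    nra.
  nra.
Qed.

Lemma integrable_normal_prob_quadratic (R : realType) (s a b : R) : 0 < s ->
  (normal_prob 0 s).-integrable [set: R] (EFin \o (fun x : R => a * x ^+ 2 + b)).
Proof.
move=> s_gt0.
have -> : EFin \o (fun x : R => a * x ^+ 2 + b) =
          ((fun x : R => a%:E * (x ^+ 2)%:E) \+ cst b%:E)%E by [].
apply: integrableD => //; last exact: finite_measure_integrable_cst.
by apply: integrableZl => //; exact: integrable_normal_prob_sqr.
Qed.

Lemma integral_probability_cst (R : realType) (d : measure_display)
    (T : measurableType d) (P : probability T R) (r : R) :
  (\int[P]_x r%:E = r%:E)%E.
Proof. by rewrite integral_cst// [X in (_ * X)%E]probability_setT mule1. Qed.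

Lemma integral_normal_prob_quadratic (R : realType) (s a b : R) : 0 < s ->
  (\int[normal_prob 0 s]_x (a * x ^+ 2 + b)%:E = (a * s ^+ 2 + b)%:E)%E.
Proof.
move=> s_gt0.
under eq_integral do rewrite EFinD EFinM.
have iX := integrable_normal_prob_sqr s_gt0.
rewrite integralD//; last 2 first.
- by apply: integrableZl => //; exact: iX.
- exact: finite_measure_integrable_cst.
rewrite (integralZl measurableT iX).
rewrite [X in (_ + X)%E](integral_probability_cst (normal_prob 0 s)).
by rewrite integral_normal_prob_sqr.
Qed.

(** * Optimality of potentials whose coupling has both marginals *)

Section coupling.
Context (R : realType) (d1 d2 : measure_display).
Context (X : measurableType d1) (Y : measurableType d2).
Variables (mu : probability X R) (nu : probability Y R) (k : X * Y -> R).
Hypotheses (k_ge0 : forall z, 0 <= k z) (mk : measurable_fun [set: X * Y] k).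

Lemma integral_density_fst : (forall x, \int[nu]_y (k (x, y))%:E = 1)%E ->
  (\int[mu \x nu]_z (k z)%:E = 1)%E.
Proof.
move=> k1; rewrite fubini_tonelli1//; last exact/measurable_EFinP.
rewrite /fubini_F; under eq_integral do rewrite k1.
exact: integral_probability_cst.
Qed.

(** For each [x], [k (x, _)] is a probability density. Tonelli applied to [|g|] gives integrability,
    and Fubini then integrates [y] out. *)
Lemma integral_density_comp_fst (g : X -> R) :
  (forall x, \int[nu]_y (k (x, y))%:E = 1)%E ->
  mu.-integrable [set: X] (EFin \o g) ->
  (mu \x nu)%E.-integrable [set: X * Y] (fun z => (g z.1 * k z)%:E) /\
  (\int[mu \x nu]_z (g z.1 * k z)%:E = \int[mu]_x (g x)%:E)%E.
Proof.
move=> k1 ig.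
have mg : measurable_fun [set: X] g by exact/measurable_EFinP/(measurable_int _ ig).
have mkx x : measurable_fun [set: Y] (fun y => k (x, y)) by exact: measurableT_comp.
have mf : measurable_fun [set: X * Y] (fun z => (g z.1 * k z)%:E).
  by apply/measurable_EFinP/measurable_funM => //; exact: measurableT_comp.
have iz : (mu \x nu)%E.-integrable [set: X * Y] (fun z => (g z.1 * k z)%:E).
  apply: (integrable12ltyP mu nu mf).2.
  have E x : (\int[nu]_y `|(g x * k (x, y))%:E| = `|(g x)%:E|)%E.
    under eq_integral => y _ do rewrite EFinM abseM [X in (_ * X)%E]gee0_abs ?lee_fin//.
    rewrite ge0_integralZl ?k1 ?mule1//.
    - exact/measurable_EFinP.
    - by move=> y _; rewrite lee_fin.
  under eq_integral do rewrite /= E.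
  by case/integrableP : ig.
split=> //; rewrite -(integral12_prod_meas1 iz).
apply: eq_integral => x _; rewrite /fubini_F /=.
under eq_integral do rewrite EFinM.
rewrite integralZl ?k1 ?mule1//.
apply/integrableP; split; first exact/measurable_EFinP.
by under eq_integral do rewrite gee0_abs ?lee_fin//; rewrite k1 ltry.
Qed.

Lemma integral_density_comp_snd (g : Y -> R) :
  (forall y, \int[mu]_x (k (x, y))%:E = 1)%E ->
  nu.-integrable [set: Y] (EFin \o g) ->
  (mu \x nu)%E.-integrable [set: X * Y] (fun z => (g z.2 * k z)%:E) /\
  (\int[mu \x nu]_z (g z.2 * k z)%:E = \int[nu]_y (g y)%:E)%E.
Proof.
move=> k1 ig.
have mg : measurable_fun [set: Y] g by exact/measurable_EFinP/(measurable_int _ ig).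
have mky y : measurable_fun [set: X] (fun x => k (x, y)) by exact: measurableT_comp.
have mf : measurable_fun [set: X * Y] (fun z => (g z.2 * k z)%:E).
  by apply/measurable_EFinP/measurable_funM => //; exact: measurableT_comp.
have iz : (mu \x nu)%E.-integrable [set: X * Y] (fun z => (g z.2 * k z)%:E).
  apply: (integrable21ltyP mu nu mf).2.
  have E y : (\int[mu]_x `|(g y * k (x, y))%:E| = `|(g y)%:E|)%E.
    under eq_integral => x _ do rewrite EFinM abseM [X in (_ * X)%E]gee0_abs ?lee_fin//.
    rewrite ge0_integralZl ?k1 ?mule1//.
    - exact/measurable_EFinP.
    - by move=> x _; rewrite lee_fin.
  under eq_integral do rewrite /= E.
  by case/integrableP : ig.
split=> //; rewrite -(integral21_prod_meas1 iz).
apply: eq_integral => y _; rewrite /fubini_G /=.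
under eq_integral do rewrite EFinM.
rewrite integralZl ?k1 ?mule1//.
apply/integrableP; split; first exact/measurable_EFinP.
by under eq_integral do rewrite gee0_abs ?lee_fin//; rewrite k1 ltry.
Qed.

End coupling.

Section schroedinger_potentials.
Context (R : realType) (d1 d2 : measure_display).
Context (X : measurableType d1) (Y : measurableType d2).
Variables (mu : probability X R) (nu : probability Y R) (c : X -> Y -> R) (lam : R).
Variables (phi : X -> R) (psi : Y -> R).
Hypothesis mc : measurable_fun [set: X * Y] (fun z => c z.1 z.2).
Hypothesis iphi : mu.-integrable [set: X] (EFin \o phi).
Hypothesis ipsi : nu.-integrable [set: Y] (EFin \o psi).

Let k (z : X * Y) := expR ((phi z.1 + psi z.2 - c z.1 z.2) / lam).

Hypothesis k_fst : (forall x, \int[nu]_y (k (x, y))%:E = 1)%E.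

Let measurable_k (f : X -> R) (g : Y -> R) :
  mu.-integrable [set: X] (EFin \o f) -> nu.-integrable [set: Y] (EFin \o g) ->
  measurable_fun [set: X * Y] (fun z => expR ((f z.1 + g z.2 - c z.1 z.2) / lam)).
Proof.
move=> /(measurable_int _)/measurable_EFinP mf /(measurable_int _)/measurable_EFinP mg.
apply: measurableT_comp => //; apply: measurable_funM => //.
apply: measurable_funB => //.
by apply: measurable_funD; exact: measurableT_comp.
Qed.

(** The kernel has total mass 1, so the penalty vanishes. One marginal condition is enough, so this
    covers every pair produced by a half-step as well as the optimal one. *)
Lemma dual_functional_normalized :
  (dual_functional mu nu c lam phi psi =
   \int[mu]_x (phi x)%:E + \int[nu]_y (psi y)%:E)%E.
Proof.
have k1 : (\int[mu \x nu]_z (k z)%:E = 1)%E.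
  apply: integral_density_fst => //.
  - by move=> z; exact: expR_ge0.
  - exact: measurable_k.
by rewrite /dual_functional [X in (1 - X)%E]k1 subee// mule0 adde0.
Qed.

Hypothesis lam_gt0 : 0 < lam.
Hypothesis k_snd : (forall y, \int[mu]_x (k (x, y))%:E = 1)%E.

(** For a competitor [(f, g)], the tangent inequality gives [h >= k (1 + u + v)] with
    [u = (f - phi) / lam] and [v = (g - psi) / lam]. The two marginal conditions turn the integral
    of the right side into that of [u] and [v] alone, so the penalty costs at least what the linear
    terms gain. *)
Lemma dual_value_normalized :
  (dual_value mu nu c lam =
   \int[mu]_x (phi x)%:E + \int[nu]_y (psi y)%:E)%E.
Proof.
have k_ge0 z : 0 <= k z by exact: expR_ge0.
have mk : measurable_fun [set: X * Y] k by exact: measurable_k.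
apply/eqP; rewrite eq_le; apply/andP; split; last first.
  rewrite -dual_functional_normalized.
  by apply: ereal_sup_ubound; exists phi => //; exists psi.
apply: ge_ereal_sup => _ [f /= intf [g /= intg <-]].
pose h z := expR ((f z.1 + g z.2 - c z.1 z.2) / lam).
have mh : measurable_fun [set: X * Y] h by exact: measurable_k.
rewrite /dual_functional.
have finI (d : measure_display) (T : measurableType d) (P : probability T R)
    (u : T -> R) : P.-integrable [set: T] (EFin \o u) ->
    {r | (\int[P]_x (u x)%:E)%E = r%:E}.
  move=> iu; exists (fine (\int[P]_x (u x)%:E)%E).
  by rewrite fineK//; exact: integrable_fin_num iu.
have scaledB (d : measure_display) (T : measurableType d) (P : probability T R)
    (p q : T -> R) (a b : R) :
    P.-integrable [set: T] (EFin \o p) -> P.-integrable [set: T] (EFin \o q) ->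
    (\int[P]_x (p x)%:E)%E = a%:E -> (\int[P]_x (q x)%:E)%E = b%:E ->
    P.-integrable [set: T] (EFin \o (fun x => (p x - q x) / lam)) /\
    (\int[P]_x ((p x - q x) / lam)%:E)%E = ((a - b) / lam)%:E.
  move=> ip iq pE qE.
  have E x : ((p x - q x) / lam)%:E = (lam^-1%:E * ((p x)%:E - (q x)%:E))%E.
    by rewrite mulrC EFinM EFinB.
  have iB := integrableB measurableT ip iq.
  split.
    rewrite (_ : EFin \o _ = (fun x => lam^-1%:E * ((p x)%:E - (q x)%:E))%E).
      exact: integrableZl.
    exact/funext.
  under eq_integral do rewrite E.
  rewrite integralZl//.
  by rewrite (integralB measurableT ip iq) /= pE qE mulrC EFinM EFinB.
have [A AE] := finI _ _ _ _ iphi; have [B BE] := finI _ _ _ _ ipsi.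
have [A' A'E] := finI _ _ _ _ intf; have [B' B'E] := finI _ _ _ _ intg.
rewrite AE BE A'E B'E.
have h_ge : ((1 + (A' - A) / lam + (B' - B) / lam)%:E <= \int[mu \x nu]_z (h z)%:E)%E.
  have [hoo|] := eqVneq (\int[mu \x nu]_z (h z)%:E)%E +oo%E; first by rewrite hoo leey.
  move=> h_fin.
  have ih : (mu \x nu)%E.-integrable [set: X * Y] (EFin \o h).
    apply/integrableP; split; first exact/measurable_EFinP.
    under eq_integral do rewrite /= ger0_norm ?expR_ge0//.
    by rewrite ltey.
  pose u x := (f x - phi x) / lam; pose v y := (g y - psi y) / lam.
  have [iu uE] := scaledB _ _ _ _ _ _ _ intf iphi A'E AE.
  have [iv vE] := scaledB _ _ _ _ _ _ _ intg ipsi B'E BE.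
  have [iuk ukE] := integral_density_comp_fst k_ge0 mk k_fst iu.
  have [ivk vkE] := integral_density_comp_snd k_ge0 mk k_snd iv.
  have ik : (mu \x nu)%E.-integrable [set: X * Y] (EFin \o k).
    apply/integrableP; split; first exact/measurable_EFinP.
    under eq_integral do rewrite /= ger0_norm ?expR_ge0//.
    by rewrite integral_density_fst// ltry.
  have kE := integral_density_fst mu k_ge0 mk k_fst.
  rewrite !EFinD -uE -vE -ukE -vkE -[1%E]kE -!integralD//; last exact: integrableD.
  apply: le_integral => //.
  - by apply: integrableD => //; exact: integrableD.
  - move=> z _; rewrite -!EFinD lee_fin.
    have -> : h z = k z * expR (u z.1 + v z.2).
      rewrite /h /k -expRD /u /v; congr expR; field.
      by rewrite gt_eqF.
    have := expR_ge1Dx (u z.1 + v z.2).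
    have := k_ge0 z.
    move=> /ler_wpM2l /[apply]; apply: le_trans.
    by rewrite 2!mulrDr mulr1 ![k z * _]mulrC addrA.
case: (integral _ _ _) h_ge => [r||]//.
- rewrite lee_fin => hr.
  rewrite -EFinB -EFinM -!EFinD lee_fin.
  have : lam * (1 + (A' - A) / lam + (B' - B) / lam) <= lam * r by rewrite ler_pM2l.
  have -> : lam * (1 + (A' - A) / lam + (B' - B) / lam) = lam + (A' - A) + (B' - B).
    by field; rewrite gt_eqF.
  lra.
(* A competitor with infinite mass has dual value [-oo]. *)
- by move=> _; rewrite /= gt0_muleNy ?lte_fin// addeNy leNye.
Qed.

End schroedinger_potentials.

(** The transform is the additive constant that normalizes the kernel, so a candidate is verified by
    one integral equal to 1. This also shows that the integral inside [ln] is finite and positive,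
    so no default value intervenes. *)
Lemma entropic_transform_eq (R : realType) (d : measure_display)
    (X : measurableType d) (Y : Type) (mu : probability X R) (c : X -> Y -> R)
    (lam : R) (f : X -> R) (y : Y) (v : R) : lam != 0 ->
  (\int[mu]_x (expR ((v + f x - c x y) / lam))%:E = 1)%E ->
  measurable_fun [set: X] f -> measurable_fun [set: X] (c ^~ y) ->
  entropic_transform mu c lam f y = v.
Proof.
move=> lam0 int1 mf mc.
rewrite /entropic_transform /Rintegral.
have -> : (\int[mu]_x (expR ((f x - c x y) / lam))%:E = (expR (- v / lam))%:E)%E.
  rewrite -[RHS]mule1 -int1 -ge0_integralZl//.
  - apply: eq_integral => x _; rewrite -EFinM -expRD; congr (expR _)%:E.
    by field.
  - apply/measurable_EFinP/measurableT_comp => //; apply: measurable_funM => //.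
    by apply: measurable_funB => //; exact: measurable_funD.
by rewrite /= expRK; field.
Qed.

(** * Gaussian Sinkhorn iterates *)

(** The terms in [x] and [ln D] are those that cancel the closed form of the Gaussian integral, once
    [sqrt D] is written as [exp (ln D / 2)]. The result serves both to compute the iterates and to
    check the marginals. *)
Lemma normal_prob_quadratic_kernel (R : realType) (s lam a b x : R) :
  0 < s -> 0 < lam -> 0 < 1 - 2 * a * s ^+ 2 / lam ->
  let D := 1 - 2 * a * s ^+ 2 / lam in
  (\int[normal_prob 0 s]_y
     (expR ((- (s ^+ 2 / (2 * lam * D)) * x ^+ 2 + (lam / 2 * ln D - b)
             + (a * y ^+ 2 + b) + x * y) / lam))%:E = 1)%E.
Proof.
move=> s_gt0 lam_gt0 D_gt0 D.
have lam0 : lam != 0 by rewrite gt_eqF.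
have D0 : D != 0 by rewrite gt_eqF.
have DE : D = 1 - 2 * (a / lam) * s ^+ 2 by rewrite /D; field.
have sqrtD : Num.sqrt D = expR (ln D / 2).
  have {1}-> : D = expR (ln D / 2) ^+ 2.
    by rewrite -expRM_natr (_ : _ * _ = ln D) ?lnK//; field.
  by rewrite sqrtr_sqr ger0_norm ?expR_ge0.
pose r := ln D / 2 - s ^+ 2 * x ^+ 2 / (2 * lam ^+ 2 * D).
have E y : (- (s ^+ 2 / (2 * lam * D)) * x ^+ 2 + (lam / 2 * ln D - b)
    + (a * y ^+ 2 + b) + x * y) / lam = r + (a / lam * y ^+ 2 + x / lam * y).
  by rewrite /r; field; rewrite lam0 D0.
under eq_integral do rewrite E expRD EFinM.
have D_gt0' : 0 < 1 - 2 * (a / lam) * s ^+ 2 by rewrite -DE.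
rewrite ge0_integralZl//; last first.
  apply/measurable_EFinP/measurableT_comp => //; apply: measurable_funD => //.
  by apply: measurable_funM => //; exact: measurable_funX.
rewrite integral_normal_prob_expR_quadratic// -DE -EFinM sqrtD -expRN -!expRD.
rewrite (_ : _ + _ = 0) ?expR0//.
by rewrite /r; field; rewrite lam0 D0.
Qed.

(** The cost is constrained only on the slice at [x], so both half-steps are covered, with the
    arguments of the cost in either order. *)
Lemma entropic_transform_normal_prob (R : realType) (s lam a b x : R)
    (c : R -> R -> R) :
  0 < s -> 0 < lam -> 0 < 1 - 2 * a * s ^+ 2 / lam ->
  (forall y, c y x = - (x * y)) ->
  let D := 1 - 2 * a * s ^+ 2 / lam in
  entropic_transform (normal_prob 0 s) c lam (fun y => a * y ^+ 2 + b) x =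
  - (s ^+ 2 / (2 * lam * D)) * x ^+ 2 + (lam / 2 * ln D - b).
Proof.
move=> s_gt0 lam_gt0 D_gt0 cE D.
apply: entropic_transform_eq.
- by rewrite gt_eqF.
- under eq_integral do rewrite cE opprK.
  exact: normal_prob_quadratic_kernel.
- by apply: measurable_funD => //; apply: measurable_funM => //; exact: measurable_funX.
- rewrite (_ : c ^~ x = fun y => - (x * y)); last exact/funext.
  by apply: measurableT_comp => //; exact: measurable_funM.
Qed.

(** One full Sinkhorn step in the variable [w]; the inner [1 + k / w] is the factor [D] of the
    half-step that integrates over [mu]. *)
Definition gaussian_update (R : realType) (k w : R) : R := 1 + k / (1 + k / w).

Definition gaussian_energy (R : realType) (k w : R) : R := ln w - w - k / w.

Lemma gaussian_update_ge1 (R : realType) (k w : R) :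
  0 <= k -> 0 <= w -> 1 <= gaussian_update k w.
Proof.
by move=> k_ge0 w_ge0; rewrite lerDl divr_ge0// addr_ge0// divr_ge0.
Qed.

Lemma iter_gaussian_update_ge1 (R : realType) (k : R) (t : nat) :
  0 <= k -> 1 <= iter t (gaussian_update k) 1.
Proof.
move=> k_ge0; elim: t => [|t IH]//=.
by apply: gaussian_update_ge1 => //; exact: le_trans IH.
Qed.

Section gaussian_sinkhorn.
Context (R : realType) (s lam : R).
Hypotheses (s_gt0 : 0 < s) (lam_gt0 : 0 < lam).

Let mu : probability _ R := normal_prob (0 : R) 1.
Let nu : probability _ R := normal_prob (0 : R) s.
Let c (x y : R) : R := - (x * y).
Let k := (s / lam) ^+ 2.

(** The quadratic coefficient is parametrized by the factor [D] of the next half-step, which is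
    exactly [w] (see [psiD]). The constant [b] cancels in [phi + psi], which is why it is only
    tracked existentially. *)
Let psi w b (y : R) : R := lam * (1 - w) / (2 * s ^+ 2) * y ^+ 2 + b.
Let phi w b (x : R) : R :=
  - (s ^+ 2 / (2 * lam * w)) * x ^+ 2 + (lam / 2 * ln w - b).

Let s0 : s != 0. Proof. by rewrite gt_eqF. Qed.
Let lam0 : lam != 0. Proof. by rewrite gt_eqF. Qed.
Let k_gt0 : 0 < k. Proof. by rewrite exprn_gt0// divr_gt0. Qed.

Let psiD w : 1 - 2 * (lam * (1 - w) / (2 * s ^+ 2)) * s ^+ 2 / lam = w.
Proof. by field; rewrite s0 lam0. Qed.

Let phiD w : w != 0 ->
  1 - 2 * (- (s ^+ 2 / (2 * lam * w))) * 1 ^+ 2 / lam = 1 + k / w.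
Proof. by move=> w0; rewrite /k; field; rewrite w0 lam0. Qed.

Let phi_coef w : 0 < w ->
  - (1 ^+ 2 / (2 * lam * (1 + k / w))) = lam * (1 - gaussian_update k w) / (2 * s ^+ 2).
Proof.
move=> w_gt0; have D_gt0 : 0 < 1 + k / w by rewrite addr_gt0// divr_gt0.
rewrite /gaussian_update; set D := 1 + _ in D_gt0 *.
rewrite /k; field; rewrite s0 lam0 andbT/=.
by rewrite gt_eqF.
Qed.

Lemma entropic_transform_nu w b : 0 < w ->
  entropic_transform nu (fun y x => c x y) lam (psi w b) = phi w b.
Proof.
move=> w_gt0; apply/funext => x.
by rewrite entropic_transform_normal_prob ?psiD.
Qed.

Lemma entropic_transform_mu w b : 0 < w -> exists b',
  entropic_transform mu c lam (phi w b) = psi (gaussian_update k w) b'.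
Proof.
move=> w_gt0; have D_gt0 : 0 < 1 + k / w by rewrite addr_gt0// divr_gt0.
exists (lam / 2 * ln (1 + k / w) - (lam / 2 * ln w - b)); apply/funext => y.
rewrite entropic_transform_normal_prob ?phiD ?gt_eqF//.
- by rewrite phi_coef.
- by move=> x; rewrite /c mulrC.
Qed.

Lemma sinkhorn_psi_gaussian t : exists b,
  sinkhorn_psi mu nu c lam (fun=> 0) t = psi (iter t (gaussian_update k) 1) b.
Proof.
elim: t => [|t [b IH]] /=.
  by exists 0; apply/funext => y; rewrite /psi subrr mulr0 !mul0r addr0.
have w_gt0 : 0 < iter t (gaussian_update k) 1.
  by apply: lt_le_trans (iter_gaussian_update_ge1 _ (ltW k_gt0)).
have [b' E] := entropic_transform_mu b w_gt0.
by exists b'; rewrite IH /phi_transform /psi_transform entropic_transform_nu.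
Qed.

Let phi_psi_integral w b : 0 < w ->
  (\int[mu]_x (phi w b x)%:E + \int[nu]_y (psi w b y)%:E =
   (lam / 2 * (1 + gaussian_energy k w))%:E)%E.
Proof.
move=> w_gt0; rewrite !integral_normal_prob_quadratic// -EFinD; congr EFin.
by rewrite /gaussian_energy /k; field; rewrite s0 lam0 gt_eqF.
Qed.

Let iphi w b : mu.-integrable [set: R] (EFin \o phi w b).
Proof. exact: integrable_normal_prob_quadratic. Qed.

Let ipsi w b : nu.-integrable [set: R] (EFin \o psi w b).
Proof. exact: integrable_normal_prob_quadratic. Qed.

Let mc : measurable_fun [set: R * R] (fun z => c z.1 z.2).
Proof. by apply: measurableT_comp => //; exact: measurable_funM. Qed.

Let kernel_fst w b x : 0 < w ->
  (\int[nu]_y (expR ((phi w b x + psi w b y - c x y) / lam))%:E = 1)%E.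
Proof.
move=> w_gt0.
rewrite -[RHS](@normal_prob_quadratic_kernel _ s lam
  (lam * (1 - w) / (2 * s ^+ 2)) b x) ?psiD//.
by apply: eq_integral => y _; rewrite /c opprK.
Qed.

Lemma gaussian_gapE W t : 0 < W -> W ^+ 2 = W + k ->
  gaussian_gap s lam t =
  (lam / 2 * (gaussian_energy k W
              - gaussian_energy k (iter t (gaussian_update k) 1)))%:E.
Proof.
move=> W_gt0 Wfix; have W0 : W != 0 by rewrite gt_eqF.
have WD : 1 + k / W = W by apply: (mulIf W0); rewrite mulrDl mul1r divfK// -Wfix.
have [b psiE] := sinkhorn_psi_gaussian t.
set w := iter _ _ _ in psiE *.
have w_gt0 : 0 < w by apply: lt_le_trans (iter_gaussian_update_ge1 _ (ltW k_gt0)).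
rewrite /gaussian_gap /dual_gap.
rewrite (@dual_value_normalized _ _ _ _ _ mu nu c lam (phi W 0) (psi W 0))//.
- rewrite /sinkhorn_phi psiE /psi_transform entropic_transform_nu//.
  rewrite dual_functional_normalized//.
  + by rewrite !phi_psi_integral// -EFinB; congr EFin; ring.
  + exact: iphi.
  + exact: ipsi.
  + by move=> x; exact: kernel_fst.
- by move=> x; exact: kernel_fst.
- move=> y.
  (* Second marginal: the half-step over [mu] started from [phi W 0] has factor [1 + k / W = W],
     hence gives back [psi W 0]. *)
  have := @normal_prob_quadratic_kernel _ 1 lam (- (s ^+ 2 / (2 * lam * W)))
    (lam / 2 * ln W - 0) y ltr01 lam_gt0.
  rewrite phiD// WD => /(_ W_gt0) <-.
  apply: eq_integral => x _; congr (expR (_ / lam))%:E.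
  have := phi_coef W_gt0; rewrite /gaussian_update !WD => ->.
  by rewrite /phi /psi /c /=; ring.
Qed.

End gaussian_sinkhorn.

(** * The scalar recursion *)

Section gaussian_recursion.
Context (R : realType) (k W : R).
Hypotheses (k_gt0 : 0 < k) (W_gt1 : 1 < W) (Wfix : W ^+ 2 = W + k).

Let W_gt0 : 0 < W. Proof. exact: lt_trans W_gt1. Qed.
Let kE : k = W * (W - 1). Proof. by rewrite mulrBr mulr1 -expr2 Wfix addrC addKr. Qed.

(** The derivative is [(v - v^2 + k) / v^2]; substituting [k = W (W - 1)] factors the numerator. *)
Lemma is_derive_gaussian_energy (v : R) : 0 < v ->
  is_derive v 1 (gaussian_energy k) ((W - v) * (v + W - 1) / v ^+ 2).
Proof.
move=> v_gt0; have v0 : v != 0 by rewrite gt_eqF.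
have dln := is_derive1_ln v_gt0.
have dV := is_deriveV v0 (is_derive_id v 1).
rewrite /gaussian_energy.
have -> : (fun w => ln w - w - k / w) = (@ln R - id - k *: (fun w : R => w^-1)).
  by apply/funext => w /=; rewrite !fctE.
apply: is_derive_eq; rewrite kE /GRing.scale /= .
by field.
Qed.

(* Mean value theorem for [gaussian_energy k v + C / 2 * (W - v) ^+ 2]: bounds on
   [(v + W - 1) / v ^+ 2] over [[w, W]] turn into quadratic bounds on the gap. *)
Let energy_mvt (C w : R) : 0 < w -> w <= W -> exists2 v, v \in `[w, W]%R &
  gaussian_energy k W - gaussian_energy k w - C / 2 * (W - w) ^+ 2 =
  (W - v) * ((v + W - 1) / v ^+ 2 - C) * (W - w).
Proof.
move=> w_gt0 wW.
pose g v := gaussian_energy k v + C / 2 * (W - v) ^+ 2.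
have dg (v : R) : 0 < v -> is_derive v 1 g ((W - v) * ((v + W - 1) / v ^+ 2 - C)).
  move=> v_gt0; have v0 : v != 0 by rewrite gt_eqF.
  have de := is_derive_gaussian_energy v_gt0.
  have -> : g = gaussian_energy k + (C / 2) *: ((cst W - id) ^+ 2).
    by apply/funext => u; rewrite /g !fctE.
  apply: is_derive_eq; rewrite /GRing.scale /= !fctE.
  by field.
have gc : {within `[w, W], continuous g}.
  apply: derivable_within_continuous => v; rewrite in_itv/= => /andP[wv _].
  by have [] := dg v (lt_le_trans w_gt0 wv).
have dgI (v : R) : v \in `]w, W[%R ->
    is_derive v 1 g ((W - v) * ((v + W - 1) / v ^+ 2 - C)).
  by rewrite in_itv/= => /andP[wv _]; apply: dg; exact: lt_trans wv.
have [v vI gE] := MVT_segment wW dgI gc.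
by exists v => //; rewrite -gE /g subrr; ring.
Qed.

(** As [W > 1], [(v + W - 1) / v^2] decreases in [v], so [C] is its value at the right end [W]. The
    cross-multiplied difference factors through [W - v]. *)
Lemma gaussian_energy_gap_ge (w : R) : 0 < w -> w <= W ->
  (2 * W - 1) / (2 * W ^+ 2) * (W - w) ^+ 2 <=
  gaussian_energy k W - gaussian_energy k w.
Proof.
move=> w_gt0 wW; rewrite -subr_ge0.
have [v] := energy_mvt ((2 * W - 1) / W ^+ 2) w_gt0 wW.
rewrite in_itv/= => /andP[wv vW].
have -> : (2 * W - 1) / W ^+ 2 / 2 = (2 * W - 1) / (2 * W ^+ 2).
  by field; rewrite gt_eqF.
move=> ->; rewrite mulr_ge0 ?subr_ge0// mulr_ge0 ?subr_ge0//.
have v_gt0 := lt_le_trans w_gt0 wv.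
rewrite ler_pdivrMr ?exprn_gt0// mulrAC ler_pdivlMr ?exprn_gt0//.
rewrite -subr_ge0.
have -> : (v + W - 1) * W ^+ 2 - (2 * W - 1) * v ^+ 2 =
  (W - v) * (W * v + (W - 1) * (W + v)) by ring.
rewrite mulr_ge0 ?subr_ge0//; apply: addr_ge0; apply: mulr_ge0;
  by rewrite ?subr_ge0 ?addr_ge0 ?ltW.
Qed.

(** By the same monotonicity [C] is now the value at the left end [w]; it tends to the constant of
    the lower bound as [w] tends to [W]. *)
Lemma gaussian_energy_gap_le (w : R) : 0 < w -> w <= W ->
  gaussian_energy k W - gaussian_energy k w <=
  (w + W - 1) / (2 * w ^+ 2) * (W - w) ^+ 2.
Proof.
move=> w_gt0 wW; rewrite -subr_le0.
have [v] := energy_mvt ((w + W - 1) / w ^+ 2) w_gt0 wW.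
rewrite in_itv/= => /andP[wv vW].
have -> : (w + W - 1) / w ^+ 2 / 2 = (w + W - 1) / (2 * w ^+ 2).
  by field; rewrite gt_eqF.
move=> ->; rewrite mulr_le0_ge0 ?subr_ge0// mulr_ge0_le0 ?subr_ge0 ?subr_le0//.
have v_gt0 := lt_le_trans w_gt0 wv.
rewrite ler_pdivrMr ?exprn_gt0// mulrAC ler_pdivlMr ?exprn_gt0//.
rewrite -subr_ge0.
have -> : (w + W - 1) * v ^+ 2 - (v + W - 1) * w ^+ 2 =
  (v - w) * (w * v + (W - 1) * (w + v)) by ring.
rewrite mulr_ge0 ?subr_ge0//; apply: addr_ge0; apply: mulr_ge0;
  by rewrite ?subr_ge0 ?addr_ge0 ?ltW.
Qed.

(** An exact contraction identity, without linearization. The factor [k / (w + k)] is positive, at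
    most 1, and at least [k / (W + k) = 1 - 1 / W] when [w <= W]; the bounds on the iterates follow
    from these three facts. *)
Lemma gaussian_update_gap (w : R) : 0 < w ->
  W - gaussian_update k w = (1 - W^-1) * (k / (w + k)) * (W - w).
Proof.
move=> w_gt0; have wk0 : w + k != 0 by rewrite gt_eqF// addr_gt0.
have wk0' : w + W * (W - 1) != 0 by rewrite -kE.
rewrite /gaussian_update kE; field.
by rewrite wk0' !gt_eqF.
Qed.

Lemma iter_gaussian_update_lt (t : nat) : iter t (gaussian_update k) 1 < W.
Proof.
elim: t => [|t IH]//=.
have w_gt0 : 0 < iter t (gaussian_update k) 1.
  exact: lt_le_trans (iter_gaussian_update_ge1 _ (ltW k_gt0)).
rewrite -subr_gt0 gaussian_update_gap// mulr_gt0 ?subr_gt0// mulr_gt0//.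
  by rewrite subr_gt0 invf_lt1.
by rewrite divr_gt0// addr_gt0.
Qed.

Let w (t : nat) : R := iter t (gaussian_update k) 1.

Let w_gt0 t : 0 < w t.
Proof. exact: lt_le_trans (iter_gaussian_update_ge1 _ (ltW k_gt0)). Qed.

Let theta : R := 1 - W^-1.

Let theta_ge0 : 0 <= theta. Proof. by rewrite subr_ge0 invf_le1// ltW. Qed.

Let thetaE : theta = k / (W + k).
Proof. by rewrite -Wfix /theta kE; field; rewrite gt_eqF. Qed.

Lemma iter_gaussian_update_gap_ge (t : nat) :
  (W - 1) * (theta ^+ 2) ^+ t <= W - w t.
Proof.
elim: t => [|t IH]; first by rewrite expr0 mulr1.
rewrite /w iterS -/(w t) gaussian_update_gap// -/theta exprS mulrCA.
apply: ler_pM => //.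
- by rewrite sqr_ge0.
- by rewrite mulr_ge0 ?exprn_ge0// ?sqr_ge0// subr_ge0 ltW.
rewrite expr2 ler_wpM2l// thetaE ler_pM2l// lef_pV2 ?posrE ?addr_gt0//.
by rewrite lerD2r ltW// iter_gaussian_update_lt.
Qed.

(** Bounding [k / (w + k)] crudely by 1 loses a factor [theta] per step, but suffices for
    convergence. *)
Lemma iter_gaussian_update_gap_le (t : nat) : W - w t <= (W - 1) * theta ^+ t.
Proof.
elim: t => [|t IH]; first by rewrite expr0 mulr1.
rewrite /w iterS -/(w t) gaussian_update_gap// -/theta exprS [leRHS]mulrCA -mulrA.
apply: ler_wpM2l => //; apply: le_trans IH.
have k_le1 : k / (w t + k) <= 1.
  by rewrite ler_pdivrMr ?addr_gt0// mul1r lerDr ltW.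
by rewrite ler_piMl// subr_ge0 ltW// iter_gaussian_update_lt.
Qed.

Lemma cvg_iter_gaussian_update : w t @[t --> \oo] --> W.
Proof.
have e0 : (W - w t) @[t --> \oo] --> (0 : R).
  apply: (@squeeze_cvgr _ _ _ _ (cst 0) (fun t => (W - 1) * theta ^+ t)).
  - near=> t; rewrite iter_gaussian_update_gap_le andbT.
    by rewrite subr_ge0 ltW// iter_gaussian_update_lt.
  - exact: cvg_cst.
  - rewrite -[X in _ --> X](mulr0 (W - 1)); apply: cvgMr.
    apply: cvg_expr; rewrite ger0_norm//.
    by rewrite ltrBlDr ltrDl invr_gt0.
have -> : w = (fun t => W - (W - w t)) by apply/funext => t; rewrite subKr.
rewrite -[X in _ --> X]subr0; apply: cvgB => //; exact: cvg_cst.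
Unshelve. all: by end_near. Qed.

Let gap t := gaussian_energy k W - gaussian_energy k (w t).

Let c1 : R := (2 * W - 1) / (2 * W ^+ 2).
Let c2 (v : R) : R := (v + W - 1) / (2 * v ^+ 2).

Let c1_gt0 : 0 < c1.
Proof.
rewrite divr_gt0 ?mulr_gt0 ?exprn_gt0// subr_gt0.
by rewrite (lt_trans W_gt1)// ltr_pMl// ltr1n.
Qed.

Let c2_gt0 v : 0 < v -> 0 < c2 v.
Proof.
by move=> v_gt0; rewrite divr_gt0 ?mulr_gt0 ?exprn_gt0// -addrA addr_gt0// subr_gt0.
Qed.

Lemma gaussian_energy_gap_gt0 t : 0 < gap t.
Proof.
have lt := iter_gaussian_update_lt t.
apply: lt_le_trans (gaussian_energy_gap_ge (w_gt0 t) (ltW lt)).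
by rewrite mulr_gt0// exprn_gt0// subr_gt0.
Qed.

(** The gap lies between [c1 (W - w)^2] and [c2 w (W - w)^2], and one step multiplies [W - w] by
    [rho w]. The ratio is thus squeezed between multiples of [rho (w t)^2] that tend to 1 times it,
    because [c2 W = c1]. *)
Lemma cvg_gaussian_energy_gap_ratio :
  (gap t.+1 / gap t) @[t --> \oo] --> theta ^+ 4.
Proof.
pose rho v := theta * (k / (v + k)).
have gapS t : W - w t.+1 = rho (w t) * (W - w t).
  by rewrite /w iterS gaussian_update_gap//; exact: w_gt0.
have lo t := gaussian_energy_gap_ge (w_gt0 t) (ltW (iter_gaussian_update_lt t)).
have up t := gaussian_energy_gap_le (w_gt0 t) (ltW (iter_gaussian_update_lt t)).
have cw := cvg_iter_gaussian_update.
have cw1 : w t.+1 @[t --> \oo] --> W by rewrite (cvg_shiftS w).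
have W0 : W != 0 by rewrite gt_eqF.
have c2W : c2 W = c1 by rewrite /c2 /c1; congr (_ / _); ring.
have crho : (rho (w t) ^+ 2) @[t --> \oo] --> theta ^+ 4.
  have -> : theta ^+ 4 = (theta * (k / (W + k))) ^+ 2 by rewrite -thetaE; ring.
  apply: cvgM; (apply: cvgMr; apply: cvgMr; apply: cvgV;
    [by rewrite gt_eqF// addr_gt0|apply: cvgD => //; exact: cvg_cst]).
have cc2 u : u t @[t --> \oo] --> W -> c2 (u t) @[t --> \oo] --> c1.
  move=> cu; rewrite -c2W; apply: cvgM.
    by apply: cvgB; [apply: cvgD => //|]; exact: cvg_cst.
  apply: cvgV; first by rewrite mulf_neq0 ?expf_neq0.
  by apply: cvgMr; exact: cvgM.
apply: (@squeeze_cvgr _ _ _ _ (fun t => c1 / c2 (w t) * rho (w t) ^+ 2)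
  (fun t => c2 (w t.+1) / c1 * rho (w t) ^+ 2)).
- near=> t; apply/andP; split.
  + rewrite ler_pdivlMr ?gaussian_energy_gap_gt0//.
    apply: le_trans (lo t.+1); rewrite gapS (exprMn _ (rho _)) -/c1.
    have H : 0 <= c1 / c2 (w t) * rho (w t) ^+ 2.
      by rewrite mulr_ge0 ?sqr_ge0// divr_ge0// ltW ?c2_gt0.
    apply: le_trans (ler_wpM2l H (up t)) _.
    rewrite -/(c2 _) le_eqVlt; apply/orP; left; apply/eqP.
    by field; rewrite gt_eqF// c2_gt0.
  + rewrite ler_pdivrMr ?gaussian_energy_gap_gt0//.
    apply: le_trans (up t.+1) _; rewrite gapS (exprMn _ (rho _)) -/(c2 _).
    have H : 0 <= c2 (w t.+1) / c1 * rho (w t) ^+ 2.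
      by rewrite mulr_ge0 ?sqr_ge0// divr_ge0// ltW ?c2_gt0.
    apply: le_trans (ler_wpM2l H (lo t)).
    rewrite -/c1 le_eqVlt; apply/orP; left; apply/eqP.
    by field; rewrite gt_eqF.
- rewrite -[X in _ --> X]mul1r; apply: cvgM => //.
  rewrite -[X in _ --> X](divff (lt0r_neq0 c1_gt0)).
  apply: cvgMr; apply: cvgV; first exact: lt0r_neq0.
  exact: cc2.
- rewrite -[X in _ --> X]mul1r; apply: cvgM => //.
  rewrite -[X in _ --> X](divff (lt0r_neq0 c1_gt0)).
  by apply: cvgM; [exact: cc2|exact: cvg_cst].
Unshelve. all: by end_near. Qed.

End gaussian_recursion.

(** * The positive fixed point and explicit estimates in [lam / s] *)

Section gaussian_fixpoint.
Context (R : realType) (s lam : R).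
Hypotheses (s_gt0 : 0 < s) (lam_gt0 : 0 < lam).

Let S : R := Num.sqrt (4 * s ^+ 2 + lam ^+ 2).

Definition gaussian_fixpoint : R :=
  (lam + Num.sqrt (4 * s ^+ 2 + lam ^+ 2)) / (2 * lam).

Local Notation W := gaussian_fixpoint.

Let S2 : S ^+ 2 = 4 * s ^+ 2 + lam ^+ 2.
Proof. by rewrite sqr_sqrtr// addr_ge0// ?sqr_ge0// mulr_ge0// sqr_ge0. Qed.

Let S_ge : 2 * s <= S.
Proof.
have s2_ge0 : 0 <= 2 * s by rewrite mulr_ge0// ltW.
rewrite -(@ler_pXn2r _ 2)// ?nnegrE ?sqrtr_ge0// S2.
by have := sqr_ge0 lam; lra.
Qed.

Let S_gt : lam < S.
Proof.
rewrite -(@ltr_pXn2r _ 2)// ?nnegrE ?sqrtr_ge0// ?(ltW lam_gt0)// S2.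
by rewrite ltrDr mulr_gt0// exprn_gt0.
Qed.

Lemma gaussian_fixpoint_gt1 : 1 < W.
Proof.
by rewrite /W ltr_pdivlMr ?mulr_gt0// mul1r mulr_natl mulr2n ltrD2l.
Qed.

Lemma gaussian_fixpointE : W ^+ 2 = W + (s / lam) ^+ 2.
Proof.
have lam0 : lam != 0 by rewrite gt_eqF.
rewrite !expr_div_n sqrrD S2 /W -/S exprMn.
by field.
Qed.

(** The fixed-point equation divided by [W^2]: a relation free of square roots that compares [1 / W]
    with [lam / s]. *)
Lemma gaussian_fixpointV : W^-1 ^+ 2 = (lam / s) ^+ 2 * (1 - W^-1).
Proof.
have W0 : W != 0 by rewrite gt_eqF// (lt_trans _ gaussian_fixpoint_gt1).
have s0 : s != 0 by rewrite gt_eqF.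
have lam0 : lam != 0 by rewrite gt_eqF.
have -> : 1 - W^-1 = (s / lam) ^+ 2 * W^-1 ^+ 2.
  have -> : (s / lam) ^+ 2 = W ^+ 2 - W by rewrite gaussian_fixpointE addrAC subrr add0r.
  by field.
by field; rewrite ?W0 ?s0 ?lam0.
Qed.

Lemma gaussian_fixpointV_le : W^-1 <= lam / s.
Proof.
have W_gt0 : 0 < W by exact: lt_trans gaussian_fixpoint_gt1.
have r_ge0 : 0 <= lam / s by rewrite divr_ge0// ltW.
rewrite -(@ler_pXn2r _ 2)// ?nnegrE ?invr_ge0 ?(ltW W_gt0)//.
rewrite gaussian_fixpointV ler_piMr ?sqr_ge0//.
by rewrite gerBl invr_ge0 ltW.
Qed.

(** With [x = 1 / W] and [r = lam / s], the relation [x^2 = r^2 (1 - x)] gives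
    [(r - x) (r + x) = r^2 x], hence [0 <= r - x <= r^2]. The constant 10 is 4 from [4 (r - x)] plus
    6 from the higher terms of [(1 - x)^4]. *)
Lemma gaussian_fixpoint_rate_bound :
  `|(1 - W^-1) ^+ 4 - (1 - 4 * lam / s)| <= 10 * (lam / s) ^+ 2.
Proof.
have W_gt0 : 0 < W by exact: lt_trans gaussian_fixpoint_gt1.
have x_le := gaussian_fixpointV_le; have xE := gaussian_fixpointV.
have x_gt0 : 0 < W^-1 by rewrite invr_gt0.
have x_le1 : W^-1 <= 1 by rewrite invf_le1// ltW// gaussian_fixpoint_gt1.
rewrite -(mulrA 4); set r := lam / s in x_le xE *; set x := W^-1 in x_le xE x_gt0 x_le1 *.
have r_gt0 : 0 < r by rewrite divr_gt0.
have rx : r - x <= r ^+ 2.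
  have H : (r - x) * (r + x) = r ^+ 2 * x by rewrite -subr_sqr xE; ring.
  rewrite -(@ler_pM2r _ (r + x)) ?addr_gt0// H.
  by rewrite ler_wpM2l ?sqr_ge0// lerDr ltW.
have x2 : x ^+ 2 <= r ^+ 2 by rewrite ler_pXn2r ?nnegrE// ltW.
have E : (1 - x) ^+ 4 - (1 - 4 * r) = 4 * (r - x) + x ^+ 2 * (6 - 4 * x + x ^+ 2) by ring.
rewrite E ger0_norm.
  have : x ^+ 2 * (6 - 4 * x + x ^+ 2) <= x ^+ 2 * 6.
    apply: ler_wpM2l; rewrite ?sqr_ge0//; nra.
  by nra.
apply: addr_ge0; first by lra.
by apply: mulr_ge0; rewrite ?sqr_ge0//; nra.
Qed.

Lemma gaussian_gap_bound (t : nat) : lam <= s / 5 ->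
  ((2 * s ^+ 6 / (s + lam) ^+ 3
    * (1 - 4 * lam / s - 4 * lam ^+ 2 / s ^+ 2) ^+ t
    * (lam / (4 * s ^+ 2)
       - Num.sqrt (4 * s ^+ 2 + lam ^+ 2) / (4 * s ^+ 2)) ^+ 2)%:E <= gaussian_gap s lam t)%E.
Proof.
move=> lam_le; set alpha := lam / _ - _.
have s0 : s != 0 by rewrite gt_eqF.
have lam0 : lam != 0 by rewrite gt_eqF.
have sl_gt0 : 0 < s + lam by rewrite addr_gt0.
have sl0 : s + lam != 0 by rewrite gt_eqF.
have W_gt1 := gaussian_fixpoint_gt1.
have W_gt0 : 0 < W by exact: lt_trans W_gt1.
have Wfix := gaussian_fixpointE.
have k_gt0 : 0 < (s / lam) ^+ 2 by rewrite exprn_gt0// divr_gt0.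
rewrite (gaussian_gapE s_gt0 lam_gt0 t W_gt0 Wfix) lee_fin.
have lt := iter_gaussian_update_lt k_gt0 W_gt1 Wfix t.
have ge1 := iter_gaussian_update_ge1 t (ltW k_gt0).
have gap_ge := gaussian_energy_gap_ge W_gt1 Wfix (lt_le_trans ltr01 ge1) (ltW lt).
have e_ge := iter_gaussian_update_gap_ge k_gt0 W_gt1 Wfix t.
set w := iter _ _ _ in lt ge1 gap_ge e_ge *.
set theta := 1 - W^-1 in e_ge.
(* [alpha] is the quadratic coefficient of the optimal [psi], so its square is a multiple of
   [(W - 1)^2], the initial value of [(W - w)^2]. *)
have alphaE : alpha = - (lam / (2 * s ^+ 2)) * (W - 1).
  by rewrite /alpha /W; field; rewrite s0 lam0.
set q := 1 - _ - _.
(* Here [lam <= s / 5] enters: [1 - 4/5 - 4/25 = 1/25]. The sign is needed to raise [q <= theta^4]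
   to the power [t]. *)
have q_ge0 : 0 <= q.
  have r_ge0 : 0 <= lam / s by rewrite divr_ge0// ltW.
  have r_le : lam / s <= 1 / 5.
    by rewrite ler_pdivrMr// mulrC mulrA mulr1.
  have -> : q = 1 - 4 * (lam / s) - 4 * (lam / s) ^+ 2 by rewrite /q; field.
  nra.
have q_le : q <= theta ^+ 4.
  have x_le := gaussian_fixpointV_le.
  have x_ge0 : 0 <= W^-1 by rewrite invr_ge0 ltW.
  have -> : q = 1 - 4 * (lam / s) - 4 * (lam / s) ^+ 2 by rewrite /q; field.
  have -> : theta ^+ 4 = 1 - 4 * W^-1 + W^-1 ^+ 2 * (2 + (W^-1 - 2) ^+ 2).
    by rewrite /theta; ring.
  have : 0 <= W^-1 ^+ 2 * (2 + (W^-1 - 2) ^+ 2).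
    by rewrite mulr_ge0 ?sqr_ge0// addr_ge0// sqr_ge0.
  have : 0 <= 4 * (lam / s) ^+ 2 by rewrite mulr_ge0// sqr_ge0.
  lra.
have coef : 2 * s ^+ 6 / (s + lam) ^+ 3 * (lam / (2 * s ^+ 2)) ^+ 2 <=
            lam / 2 * ((2 * W - 1) / (2 * W ^+ 2)).
  have Spos : 0 < S by apply: lt_le_trans S_ge; rewrite mulr_gt0.
  have -> : 2 * s ^+ 6 / (s + lam) ^+ 3 * (lam / (2 * s ^+ 2)) ^+ 2 =
            lam / 2 * (s ^+ 2 * lam / (s + lam) ^+ 3).
    by field; rewrite s0 sl0.
  pose den := lam ^+ 2 + S * lam + 2 * s ^+ 2.
  have den_gt0 : 0 < den by rewrite !addr_gt0 ?mulr_gt0 ?exprn_gt0.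
  have -> : (2 * W - 1) / (2 * W ^+ 2) = S * lam / den.
    have -> : 2 * W - 1 = S / lam by rewrite /W -/S; field.
    have -> : 2 * W ^+ 2 = den / lam ^+ 2 by rewrite Wfix /W -/S /den; field.
    by field; rewrite gt_eqF.
  rewrite ler_pM2l ?divr_gt0// ler_pdivrMr ?exprn_gt0// [leRHS]mulrAC ler_pdivlMr//.
  rewrite -subr_ge0.
  (* The difference is affine in [S]; expanded around [S = 2 s], the lower bound of [S_ge], it has
     only nonnegative coefficients. *)
  have -> : S * lam * (s + lam) ^+ 3 - s ^+ 2 * lam * den =
    lam * ((S - 2 * s) * (s ^+ 3 + 2 * (s ^+ 2 * lam) + 3 * (s * lam ^+ 2) + lam ^+ 3)
           + (4 * (s ^+ 3 * lam) + 5 * (s * lam) ^+ 2 + 2 * (s * lam ^+ 3))).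
    by rewrite /den; ring.
  apply: mulr_ge0; first exact: ltW.
  apply: addr_ge0; first (apply: mulr_ge0; first by rewrite subr_ge0).
    by rewrite !addr_ge0 ?mulr_ge0 ?exprn_ge0 ?mulr_ge0 ?exprn_ge0 ?(ltW s_gt0) ?(ltW lam_gt0).
  by rewrite !addr_ge0 ?mulr_ge0 ?exprn_ge0 ?mulr_ge0 ?exprn_ge0 ?(ltW s_gt0) ?(ltW lam_gt0).
rewrite alphaE exprMn sqrrN.
have e_ge0 : 0 <= (W - 1) * (theta ^+ 2) ^+ t.
  apply: mulr_ge0; first by rewrite subr_ge0 ltW.
  by rewrite exprn_ge0// sqr_ge0.
have e2_ge : (W - 1) ^+ 2 * (theta ^+ 4) ^+ t <= (W - w) ^+ 2.
  have -> : (W - 1) ^+ 2 * (theta ^+ 4) ^+ t = ((W - 1) * (theta ^+ 2) ^+ t) ^+ 2.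
    by rewrite [RHS]exprMn -!exprM; congr (_ * _); rewrite mulnAC.
  by rewrite ler_pXn2r// nnegrE// subr_ge0 ltW.
apply: (@le_trans _ _ (lam / 2 * ((2 * W - 1) / (2 * W ^+ 2)) * (W - w) ^+ 2)).
  rewrite [leLHS](_ : _ = 2 * s ^+ 6 / (s + lam) ^+ 3 * (lam / (2 * s ^+ 2)) ^+ 2
    * ((W - 1) ^+ 2 * q ^+ t)); last by ring.
  apply: ler_pM => //.
  - by rewrite mulr_ge0 ?sqr_ge0// divr_ge0 ?mulr_ge0 ?exprn_ge0 ?ltW.
  - by rewrite mulr_ge0 ?sqr_ge0 ?exprn_ge0.
  - apply: le_trans e2_ge; apply: ler_wpM2l; first exact: sqr_ge0.
    by rewrite lerXn2r// nnegrE// (le_trans q_ge0).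
by rewrite -mulrA ler_pM2l// divr_gt0.
Qed.

End gaussian_fixpoint.

Theorem theorem6p1 (R : realType) (sigma : R) (sigma_gt0 : 0 < sigma) :
  (forall lam : R, 0 < lam -> lam <= sigma / 5 -> forall t : nat,
    let alpha := lam / (4 * sigma ^+ 2)
                 - Num.sqrt (4 * sigma ^+ 2 + lam ^+ 2) / (4 * sigma ^+ 2) in
    ((2 * sigma ^+ 6 / (sigma + lam) ^+ 3
      * (1 - 4 * lam / sigma - 4 * lam ^+ 2 / sigma ^+ 2) ^+ t
      * alpha ^+ 2)%:E <= gaussian_gap sigma lam t)%E)
  /\
  (exists rate : R -> R,
    (\forall lam \near (0 : R)^'+,
      (fun t => gaussian_gap sigma lam t.+1 / gaussian_gap sigma lam t)%E
        @ \oo --> (rate lam)%:E)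
    /\ (fun lam : R => rate lam - (1 - 4 * lam / sigma)) =o_ (0^'+) id).
Proof.
split=> [lam lam_gt0 lam_le t|]; first exact: gaussian_gap_bound.
exists (fun lam => (1 - (gaussian_fixpoint sigma lam)^-1) ^+ 4); split.
- near=> lam.
  have lam_gt0 : 0 < lam by [].
  have W_gt1 := gaussian_fixpoint_gt1 sigma_gt0 lam_gt0.
  have W_gt0 : 0 < gaussian_fixpoint sigma lam by exact: lt_trans W_gt1.
  have Wfix := gaussian_fixpointE sigma lam_gt0.
  have k_gt0 : 0 < (sigma / lam) ^+ 2 by rewrite exprn_gt0// divr_gt0.
  have gap0 t := gt_eqF (gaussian_energy_gap_gt0 k_gt0 W_gt1 Wfix t).
  (* The quotient is taken in the extended reals; both gaps are finite and the denominator is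
     nonzero, so it is a real quotient in which [lam / 2] cancels. *)
  under eq_fun => t.
    rewrite !(gaussian_gapE sigma_gt0 lam_gt0 _ W_gt0 Wfix).
    rewrite inver mulf_eq0 gap0 orbF [_ == 0]gt_eqF ?divr_gt0// -EFinM.
    rewrite -mulf_div divff ?mul1r; last by rewrite gt_eqF// divr_gt0.
    over.
  apply: cvg_EFin; first by near=> t.
  exact: cvg_gaussian_energy_gap_ratio.
- apply/eqoP => e e_gt0; near=> lam.
  have lam_gt0 : 0 < lam by [].
  apply: le_trans (gaussian_fixpoint_rate_bound sigma_gt0 lam_gt0) _.
  rewrite (ger0_norm (ltW lam_gt0)).
  (* This threshold makes [10 (lam / sigma)^2] at most [e lam]. *)
  have lam_lt : lam < e * sigma ^+ 2 / 10.
    near: lam; apply: nbhs_right_lt; by rewrite divr_gt0// mulr_gt0// exprn_gt0.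
  have -> : 10 * (lam / sigma) ^+ 2 = lam * (10 / sigma ^+ 2) * lam.
    by field; rewrite gt_eqF.
  rewrite ler_wpM2r ?(ltW lam_gt0)// mulrA ler_pdivrMr ?exprn_gt0//.
  by move: lam_lt; rewrite ltr_pdivlMr// => /ltW.
Unshelve. all: by end_near. Qed.
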